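(* Let $\eta\in(0,1)$ and $d=\Omega(\log n)$. For a stream of $n$ triples $(q_i,k_i,v_i)\in(\mathbb{R}^d)^3$ and window width $W$, let $W_n:=\operatorname{Attn}_W(q_n,K_n,V_n)\in\mathbb{R}^d$. Any streaming algorithm that can, with probability at least $9/10$, produce an output $o_n\in\mathbb{R}^d$ such that $$|o_{nj}-W_{nj}|\le\eta\cdot W_{nj}\quad\text{for all } j\in[d]$$ must use at least $\Omega(dW)$ bits of memory.
   Context: The input is a stream of $n$ triples $(q_i,k_i,v_i)\in(\mathbb{R}^d)^3$ arriving one at a time. A (possibly randomized) one-pass streaming algorithm processes the triples in order, keeping a memory state whose size in bits is its space usage; its guarantee must hold for every input stream, the probability being over its own randomness. $K_n$ and $V_n$ are the $n\times d$ matrices whose rows are $k_1^T,\dots,k_n^T$ and $v_1^T,\dots,v_n^T$. Sliding window attention with unmasked values: let $S_n:=K_nq_n\in\mathbb{R}^n$, let $M\in\mathbb{R}^n$ be the mask $M_i=\mathbb{1}\{i>n-W\}$, and let $h(S_n):=S_n\circ M$ (element-wise product). Then $\operatorname{Attn}_W(q_n,K_n,V_n):=\sigma(h(S_n))^TV_n$, where $\sigma$ is the softmax on $\mathbb{R}^n$; that is, the softmax is taken of the score vector $(0,\dots,0,q_n^Tk_{n-W+1},\dots,q_n^Tk_n)$, so positions outside the window have score $0$ (unnormalized weight $1$) and still contribute their value vectors. *)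

(* Defs.v *)
From HB Require Import structures.
From mathcomp Require Import all_boot all_order all_algebra.
From mathcomp Require Import all_classical all_reals all_analysis.
Import Order.TTheory GRing.Theory Num.Theory.
Set Implicit Arguments.
Unset Strict Implicit.
Unset Printing Implicit Defensive.
Local Open Scope classical_set_scope.
Local Open Scope ring_scope.

Section Attention.
Variables (R : realType) (d : nat).

Definition softmax (n : nat) (z : 'cV[R]_n) : 'cV[R]_n :=
  \col_i (expR (z i 0) / \sum_k expR (z k 0)).

(* Rows are 0-based: the 1-based position of row [i] is [i.+1]. *)
Definition window_mask (n W : nat) : 'cV[R]_n :=
  \col_(i < n) (n - W < i.+1)%N%:R.

(* The scores, not the softmax weights, are masked: a row outside the window
   keeps the unnormalized weight [expR 0 = 1]. *)
Definition attn (n W : nat) (q : 'rV[R]_d) (K V : 'M[R]_(n, d)) : 'rV[R]_d :=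
  (softmax (map2_mx *%R (K *m q^T) (window_mask n W)))^T *m V.

Record token := Token
  { query : 'rV[R]_d; key : 'rV[R]_d; value : 'rV[R]_d }.

Definition key_mx (n : nat) (x : n.-tuple token) : 'M[R]_(n, d) :=
  \matrix_(i < n) key (tnth x i).

Definition value_mx (n : nat) (x : n.-tuple token) : 'M[R]_(n, d) :=
  \matrix_(i < n) value (tnth x i).

(* The default [Token 0 0 0] is only reached by the empty stream. *)
Definition last_query (n : nat) (x : n.-tuple token) : 'rV[R]_d :=
  query (last (Token 0 0 0) x).

Definition stream_attn (n W : nat) (x : n.-tuple token) : 'rV[R]_d :=
  attn W (last_query x) (key_mx x) (value_mx x).

Definition entries_in (X : set R) (n : nat) (x : n.-tuple token) : Prop :=
  forall (i : 'I_n) (j : 'I_d),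
    [/\ X (query (tnth x i) 0 j), X (key (tnth x i) 0 j)
      & X (value (tnth x i) 0 j)].

End Attention.

(* A one-pass algorithm with [s] bits of memory. On reading a triple it
   replaces its memory and emits an output, both computed from the old memory,
   the triple just read and the random outcome [w]. Neither the random outcome
   nor the time index counts as memory; as [step] and [out] depend on the time
   index, this covers fresh coins at every step as well as coins shared between
   steps. Outputs are exact reals. *)
Record streaming_alg (R : realType) (disp : measure_display)
    (Om : measurableType disp) (s d : nat) := StreamingAlg {
  init : s.-tuple bool;
  step : Om -> nat -> s.-tuple bool -> token R d -> s.-tuple bool;
  out : Om -> nat -> s.-tuple bool -> token R d -> 'rV[R]_d;
  measurable_step : forall i m x m',
    measurable [set w | step w i m x = m'];
  measurable_out : forall i m x (j : 'I_d),
    measurable_fun setT (fun w => out w i m x 0 j) }.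

Section Guarantee.
Variables (R : realType) (disp : measure_display) (Om : measurableType disp).
Variables (s d : nat) (A : streaming_alg R Om s d).

(* [i] is the time, [m] the current memory, [o] the latest output. *)
Fixpoint run (w : Om) (i : nat) (m : s.-tuple bool) (o : 'rV[R]_d)
    (x : seq (token R d)) : 'rV[R]_d :=
  if x is t :: x' then run w i.+1 (step A w i m t) (out A w i m t) x' else o.

Definition final_output (w : Om) (x : seq (token R d)) : 'rV[R]_d :=
  run w 0 (init A) 0 x.

(* The inequality [`|o - a| <= eta * a] has no solution [o] when [a < 0], so
   nothing is required of a stream whose exact answer has a negative entry. *)
Definition approximates_attn (P : probability Om R) (eta : R) (X : set R)
    (n W : nat) : Prop :=
  forall x : n.-tuple (token R d), entries_in X x ->
    (forall j, 0 <= stream_attn W x 0 j) ->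
    (((9 / 10 : R)%:E <=
      P [set w | forall j : 'I_d,
           (`|final_output w x 0 j - stream_attn W x 0 j|
             <= eta * stream_attn W x 0 j)%R])%E).

End Guarantee.

(* [X] is the set of numbers that may occur as entries of the input; it is only
   asked to contain the integers of [b * log2 n] bits. For [X = setT] the input
   is an arbitrary stream over [R^d]; no algorithm with finite memory is correct
   on all of those, so the general [X] is what gives the bound its content. *)
Definition has_small_ints (R : realType) (n b : nat) (X : set R) : Prop :=
  forall z : int, (`|z| <= n ^ b)%N -> X z%:~R.

(* Main.v *)
(** The bound is a reduction from the one-way INDEX problem with N = d m bits,
    where m = max(1, W - 1), or m = 1 when d = 1. The m triples before the last
    one carry the bits as their value vectors, every earlier triple is zero, and
    the last triple is the query. For m > 1 the keys are points (a, a^2) on a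
    parabola and the query for row a is a multiple L of the tangent functional
    (2a, -1), whose score at (b, b^2) is L (a^2 - (a - b)^2); hence the softmax
    weight of row a dominates those of the other rows, and comparing the output
    with a known threshold reads off the bits of row a. This needs only two
    coordinates and integers of O(log n) bits; when d = 1, the hypothesis on d
    bounds n. A single row needs no separation of keys, nor to lie inside the
    window, since a relative error separates 0 from a positive number.

    By averaging, some random outcome is good for 9/10 of the pairs of a bit
    string and a row. For it the memory before the query determines the bits up
    to average Hamming distance N / 10, and an exponential moment of this
    distance gives N <= 4 s. *)
Require Import Defs.
From HB Require Import structures.
From mathcomp Require Import all_boot all_order all_algebra.
From mathcomp Require Import all_classical all_reals all_analysis.
From mathcomp Require Import measurable_realfun zify ring lra.
Import Order.TTheory GRing.Theory Num.Theory.
Local Open Scope classical_set_scope.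
Local Open Scope ring_scope.

(** * Hamming distance and the encoding bound *)

Definition hamming {T : finType} (x y : {ffun T -> bool}) : nat :=
  \sum_t (x t != y t).

(** The sum factors over coordinates: each contributes 1 where the bits agree and [q] where they
    differ. *)
Lemma sum_exp_hamming {R : comNzRingType} {T : finType} (q : R)
    (y : {ffun T -> bool}) :
  \sum_(x : {ffun T -> bool}) q ^+ hamming y x = (1 + q) ^+ #|T|.
Proof.
transitivity (\prod_(t : T) \sum_(b : bool) q ^+ (y t != b)).
  rewrite bigA_distr_bigA /=; apply: eq_bigr => x _.
  by rewrite /hamming expr_sum.
rewrite -[RHS]prodr_const; apply: eq_bigr => t _.
by rewrite big_bool; case: (y t); rewrite /= expr0 expr1 // addrC.
Qed.

(* With [h] the distance from [x] to its decoding, [exp (N / 10 - h)] has mean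
   at least 1 over [x] by [1 + u <= exp u]; on the other hand its sum over [x]
   is at most that over all pairs of a string and a codeword. *)
Lemma average_hamming_bound (R : realType) (T M : finType)
    (f : {ffun T -> bool} -> M) (g : M -> {ffun T -> bool}) (s : nat) :
  #|M| = (2 ^ s)%N ->
  (10 * (\sum_x hamming (g (f x)) x) <= #|T| * 2 ^ #|T|)%N ->
  (#|T| <= 4 * s)%N.
Proof.
move=> cardM avg; set N := #|T|; pose h x := hamming (g (f x)) x.
pose e1 : R := expR (- 1).
have cardT : #|{: {ffun T -> bool}}| = (2 ^ N)%N by rewrite card_ffun card_bool.
have lower : (2 ^ N)%:R <= \sum_x expR (N%:R / 10 - (h x)%:R : R).
  apply: (@le_trans _ _ (\sum_x (1 + (N%:R / 10 - (h x)%:R) : R))).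
    rewrite big_split /= sumr_const cardT sumrB sumr_const cardT -natr_sum.
    rewrite lerDl subr_ge0.
    have : ((10 * \sum_x h x)%:R <= (N * 2 ^ N)%:R :> R) by rewrite ler_nat.
    rewrite !natrM -mulr_natr; lra.
  by apply: ler_sum => x _; exact: expR_ge1Dx.
have upper : \sum_x expR (N%:R / 10 - (h x)%:R : R) <=
    (2 ^ s)%:R * (expR (1 / 10) * (1 + e1)) ^+ N.
  have -> : \sum_x expR (N%:R / 10 - (h x)%:R : R) =
      expR (1 / 10) ^+ N * \sum_x e1 ^+ h x.
    rewrite mulr_sumr; apply: eq_bigr => x _.
    by rewrite expRD -!expRM_natl mulrN1 mul1r.
  rewrite exprMn mulrCA ler_wpM2l ?exprn_ge0 ?expR_ge0 //.
  apply: (@le_trans _ _ (\sum_x \sum_(mu : M) e1 ^+ hamming (g mu) x)).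
    apply: ler_sum => x _; rewrite (bigD1 (f x)) //= lerDl sumr_ge0 // => mu _.
    by rewrite exprn_ge0 ?expR_ge0.
  rewrite exchange_big /=; under eq_bigr do rewrite sum_exp_hamming.
  by rewrite sumr_const cardM mulr_natl.
(* What matters is a constant below 2; [1 + u <= exp u], used twice, gives 10/9 times 3/2. *)
have ratio : expR (1 / 10) * (1 + e1) <= 5 / 3.
  have e1_le : e1 <= 1 / 2.
    have := expR_ge1Dx (1 : R); rewrite /e1 expRN => ?.
    by rewrite mul1r lef_pV2 ?posrE ?expR_gt0 //; lra.
  have e10_le : expR (1 / 10 : R) <= 10 / 9.
    have := expR_ge1Dx (- (1 / 10) : R); rewrite expRN => e10.
    rewrite -[leLHS]invrK -[leRHS]invrK lef_pV2 ?posrE ?invr_gt0 ?expR_gt0 //.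
    lra.
  have := expR_gt0 (1 / 10 : R); have := expR_gt0 (- 1 : R); rewrite -/e1; nra.
have e_ge0 : 0 <= expR (1 / 10) * (1 + e1).
  by rewrite mulr_ge0 ?addr_ge0 ?expR_ge0.
have cmp : (2 : R) ^+ N <= 2 ^+ s * (5 / 3) ^+ N.
  rewrite -!natrX; apply: (le_trans lower); apply: (le_trans upper).
  by rewrite ler_wpM2l // lerXn2r // nnegrE; lra.
have p53 : 0 < (5 / 3 : R) ^+ N by rewrite exprn_gt0 //; lra.
(* Here 6/5 is 2 divided by 5/3, and the 4 in [4 * s] comes from (6/5)^4 >= 2. *)
have : (6 / 5 : R) ^+ N <= (6 / 5) ^+ (4 * s).
  apply: (@le_trans _ _ (2 ^+ s)).
    rewrite -(ler_pM2r p53) -exprMn (_ : 6 / 5 * (5 / 3) = 2 :> R) //; lra.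
  have le2 : 2 <= (6 / 5 : R) ^+ 4 by rewrite !exprS expr0; lra.
  by rewrite exprM lerXn2r ?nnegrE // (le_trans _ le2).
by rewrite ler_eXn2l //; lra.
Qed.

(** * Fixing the random outcome *)

Lemma exists_average_outcome {R : realType} {disp : measure_display}
    {Om : measurableType disp} (P : probability Om R) {I : finType} (i0 : I)
    (E : I -> set Om) :
  (forall i, measurable (E i)) ->
  (forall i, ((9 / 10 : R)%:E <= P (E i))%E) ->
  exists w, (9 * #|I| <= 10 * \sum_i (w \in E i))%N.
Proof.
move=> mE PE; apply: contrapT => /forallNP none.
have few w : (10 * \sum_i (w \in E i) + 1 <= 9 * #|I|)%N.
  by rewrite addn1 ltnNge; apply/negP/none.
have I_gt0 : (0 < #|I|)%N by apply/card_gt0P; exists i0.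
(* Counts are integers, so failure at every [w] leaves a uniform margin of 1/10, and the inequality
   stays strict after integration. *)
pose c : R := (9 * #|I|%:R - 1) / 10.
have c_ge0 : 0 <= c.
  have : (1 <= #|I|%:R :> R) by rewrite ler1n.
  by rewrite /c; lra.
have mindic i : measurable_fun setT (fun w => (\1_(E i) w : R)%:E).
  by apply/measurable_EFinP; exact: measurable_indic.
have indic_ge0 i w : (0 <= (\1_(E i) w : R)%:E)%E by rewrite lee_fin.
have : (\int[P]_w \sum_i (\1_(E i) w : R)%:E <= \int[P]_w c%:E)%E.
  apply: ge0_le_integral => //.
  - by move=> w _; apply: sume_ge0 => i _; rewrite lee_fin.
  - by apply: emeasurable_sum.
  - move=> w _; rewrite sumEFin lee_fin.
    under eq_bigr do rewrite indicE.
    rewrite -natr_sum; have := few w; rewrite -(ler_nat R) natrD !natrM /c; lra.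
have -> := ge0_integral_sum P measurableT mindic (fun i w _ => indic_ge0 i w).
rewrite (integral_cst P measurableT) [X in (_ * X)%E]probability_setT mule1.
under eq_bigr do rewrite (integral_indic P measurableT) // setIT.
apply/negP; rewrite -ltNge.
have /lt_le_trans : (c%:E < \sum_(i : I) (9 / 10 : R)%:E)%E.
  rewrite sumEFin lte_fin sumr_const -mulr_natr /c; lra.
by apply; apply: lee_sum => i _; exact: PE.
Qed.

(** * Memory states and measurability of the output *)

Section Runs.
Context {R : realType} {disp : measure_display} {Om : measurableType disp}.
Context {s d : nat} (A : streaming_alg R Om s d).

Fixpoint memory (w : Om) (i : nat) (m : s.-tuple bool) (x : seq (token R d)) :
    s.-tuple bool :=
  if x is t :: x' then memory w i.+1 (step A w i m t) x' else m.

(** The one-way structure: the prefix affects the last output only through the memory it leaves. *)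
Lemma run_rcons w i m o x t :
  run A w i m o (rcons x t) = out A w (i + size x) (memory w i m x) t.
Proof.
elim: x i m o => [|u x IHx] i m o /=; first by rewrite addn0.
by rewrite IHx addSnnS.
Qed.

(** There are finitely many memories, so each event splits over the previous one. The start [mem]
    depends on [w] because the induction absorbs the first step into it. *)
Lemma measurable_memory x i (mem : Om -> s.-tuple bool) :
  (forall m, measurable [set w | mem w = m]) ->
  forall m, measurable [set w | memory w i (mem w) x = m].
Proof.
elim: x i mem => [|t x IHx] i mem mmem //=.
apply: (IHx _ (fun w => step A w i (mem w) t)) => m'.
rewrite (_ : mkset _ = \bigcup_(m in setT)
  ([set w | mem w = m] `&` [set w | step A w i m t = m'])).
  apply: fin_bigcup_measurable => // m _.
  by apply: measurableI => //; exact: measurable_step.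
by apply/seteqP; split => [w /= <-|w [m _ [/= -> ->]]] //; exists (mem w).
Qed.

Lemma measurable_final_output x j :
  measurable_fun setT (fun w => final_output A w x 0 j).
Proof.
rewrite /final_output; case/lastP: x => [|x t]; first exact: measurable_cst.
under eq_fun do rewrite run_rcons.
(* [out] is measurable for each fixed memory, so the output is split over the finitely many
   memories. *)
rewrite (_ : (fun w => _) = fun w => \sum_m
  \1_[set w | memory w 0 (init A) x = m] w * out A w (0 + size x) m t 0 j).
  apply: measurable_sum => m; apply: measurable_funM;
    last exact: measurable_out.
  apply: measurable_indic; apply: (@measurable_memory _ _ (fun=> init A)) => m'.
  have [->|ne] := eqVneq (init A) m'.
    by rewrite (_ : mkset _ = setT) //; apply/seteqP; split.
  rewrite (_ : mkset _ = set0) //; apply/seteqP; split => // w /= /eqP.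
  by rewrite (negbTE ne).
apply/funext => w; rewrite (bigD1 (memory w 0 (init A) x)) //= indicE.
rewrite mem_set // mul1r big1 ?addr0 // => m ne; rewrite indicE memNset ?mul0r //=.
by move=> eqm; rewrite eqm eqxx in ne.
Qed.

End Runs.

(** * Reading a bit off a threshold *)

(** Let a be the exact sum. A set bit gives o >= (1 - eta) a >= (1 - eta) u p0. A clear bit leaves
    at most n - 1 terms, each at most (1 - eta) u p0 / (n (1 + eta)), so o <= (1 + eta) a is
    strictly below the threshold. *)
Lemma threshold_decodes {R : realFieldType} {n : nat} (eta : R)
    (u : 'I_n -> R) (v : 'I_n -> bool) (p0 : 'I_n) (o : R) :
  0 < eta < 1 -> (forall p, 0 < u p) ->
  (forall p, p != p0 -> v p -> u p * (n%:R * (1 + eta)) <= (1 - eta) * u p0) ->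
  `|o - \sum_p u p * (v p)%:R| <= eta * \sum_p u p * (v p)%:R ->
  ((1 - eta) * u p0 <= o) = v p0.
Proof.
move=> /andP[eta_gt0 eta_lt1] u_gt0 gap; set a := \sum_p _.
rewrite ler_distl => /andP[lo hi].
have u0 := u_gt0 p0.
have aE : a = u p0 * (v p0)%:R + \sum_(p | p != p0) u p * (v p)%:R.
  by rewrite /a (bigD1 p0).
have [vp0|vp0] := boolP (v p0); rewrite ?vp0 ?(negbTE vp0) in aE.
  have S_ge0 : 0 <= \sum_(p | p != p0) u p * (v p)%:R.
    by apply: sumr_ge0 => p _; rewrite mulr_ge0 // ltW.
  apply/idP; apply: le_trans lo.
  rewrite (_ : a - _ = (1 - eta) * a); last by ring.
  by rewrite ler_pM2l ?subr_gt0 // aE mulr1 lerDl.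
apply/negbTE; rewrite -ltNge.
have n_gt0 : 0 < n%:R :> R by rewrite ltr0n; apply: leq_ltn_trans (ltn_ord p0).
rewrite -(ltr_pM2l n_gt0).
have small : a * (n%:R * (1 + eta)) <= n.-1%:R * ((1 - eta) * u p0).
  rewrite aE mulr0 add0r mulr_suml.
  rewrite (_ : n.-1%:R * _ = \sum_(p | p != p0) (1 - eta) * u p0); last first.
    by rewrite sumr_const cardC1 card_ord mulr_natl.
  apply: ler_sum => p pp0; have [vp|_] := boolP (v p).
    by rewrite mulr1 gap.
  by rewrite mulr0 mul0r mulr_ge0 ?subr_ge0 ?ltW.
have nE : n%:R = n.-1%:R + 1 :> R.
  by rewrite natr1 prednK //; rewrite ltr0n in n_gt0.
have : 0 < (1 - eta) * u p0 by rewrite mulr_gt0 // subr_gt0.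
have : n%:R * o <= n%:R * (a + eta * a) by rewrite ler_pM2l.
move: small; rewrite nE; lra.
Qed.

(** * The hard streams *)

Section HardStream.
Context {R : realType} {d : nat} (k : nat) {m : nat}.
Variables keys queries : 'I_m -> 'rV[R]_d.
Hypothesis m_le_k : (m <= k)%N.

Definition position (a : 'I_m) : nat := k - m + a.

(** Partial inverse of [position]; padding rows and the query row get [None]. *)
Definition slot (p : nat) : option 'I_m := [pick a | position a == p].

Lemma slot_position a : slot (position a) = Some a.
Proof.
rewrite /slot; case: pickP => [b /eqP/addnI/val_inj -> //|/(_ a)].
by rewrite eqxx.
Qed.

Lemma slotP p b : slot p = Some b -> position b = p.
Proof. by rewrite /slot; case: pickP => // c /eqP + [<-]. Qed.

Lemma position_lt a : (position a < k)%N.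
Proof. by have := ltn_ord a; rewrite /position; lia. Qed.

Definition bit_token (x : {ffun 'I_m * 'I_d -> bool}) (a : 'I_m) : token R d :=
  Token 0 (keys a) (\row_j (x (a, j))%:R).

Definition query_token (a : 'I_m) : token R d := Token (queries a) 0 0.

Definition hard_prefix (x : {ffun 'I_m * 'I_d -> bool}) :
    k.-tuple (token R d) :=
  [tuple oapp (bit_token x) (Token 0 0 0) (slot p) | p < k].

Definition hard_stream (x : {ffun 'I_m * 'I_d -> bool}) (a : 'I_m) :
    k.+1.-tuple (token R d) :=
  [tuple of rcons (hard_prefix x) (query_token a)].

Lemma tnth_stream x a (p : 'I_k.+1) :
  tnth (hard_stream x a) p =
    if (p < k)%N then oapp (bit_token x) (Token 0 0 0) (slot p)
    else query_token a.
Proof.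
rewrite (tnth_nth (query_token a)) [LHS](nth_rcons _ (hard_prefix x)).
rewrite size_tuple.
case: ltnP => [pk|_]; last by case: ifP.
by rewrite -[nth _ _ p](tnth_nth _ _ (Ordinal pk)) tnth_mktuple.
Qed.

Lemma slot_last (p : nat) : (p < k)%N = false -> slot p = None.
Proof.
by case E: (slot p) => [a|//]; rewrite -(slotP _ _ E) position_lt.
Qed.

Definition stream_keys : 'M[R]_(k.+1, d) := \matrix_p oapp keys 0 (slot p).

(** The keys do not depend on the bits, so the decoder knows all softmax weights and hence the
    threshold. *)
Lemma key_mx_stream x a : key_mx (hard_stream x a) = stream_keys.
Proof.
apply/row_matrixP => p; rewrite !rowK tnth_stream.
by case: ifP => [_|/slot_last -> //]; case: slot.
Qed.

Definition stream_bit (x : {ffun 'I_m * 'I_d -> bool}) (j : 'I_d) (p : nat) :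
    bool :=
  oapp (fun a => x (a, j)) false (slot p).

Lemma value_mx_stream x a p j :
  value_mx (hard_stream x a) p j = (stream_bit x j p)%:R.
Proof.
rewrite /value_mx mxE tnth_stream /stream_bit.
case: ifP => [_|/slot_last ->] /=; last by rewrite mxE.
by case: slot => [b|] /=; rewrite mxE.
Qed.

Variable W : nat.

Definition scores (a : 'I_m) : 'cV[R]_k.+1 :=
  map2_mx *%R (stream_keys *m (queries a)^T) (window_mask R k.+1 W).

Lemma stream_attnE x a j :
  stream_attn W (hard_stream x a) 0 j =
    \sum_p softmax (scores a) p 0 * (stream_bit x j p)%:R.
Proof.
rewrite /stream_attn /attn key_mx_stream /last_query /= last_rcons /= mxE.
by apply: eq_bigr => p _; rewrite mxE value_mx_stream.
Qed.

Lemma softmaxE n (z : 'cV[R]_n) i :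
  softmax z i 0 = expR (z i 0) / \sum_p expR (z p 0).
Proof. by rewrite mxE. Qed.

Lemma sum_expR_gt0 n (z : 'cV[R]_n.+1) : 0 < \sum_p expR (z p 0).
Proof.
rewrite big_ord_recl ltr_pwDl ?expR_gt0 //.
by apply: sumr_ge0 => p _; rewrite expR_ge0.
Qed.

Lemma softmax_gt0 n (z : 'cV[R]_n.+1) i : 0 < softmax z i 0.
Proof. by rewrite softmaxE divr_gt0 ?expR_gt0 ?sum_expR_gt0. Qed.

(** The query row takes one place of the window, so all [m] rows before it fit when m < W. *)
Lemma scoresE a b (p : 'I_k.+1) : (m < W)%N -> slot p = Some b ->
  scores a p 0 = (keys b *m (queries a)^T) 0 0.
Proof.
move=> mW pb; rewrite !mxE (_ : (_ < _)%N = true) ?mulr1.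
  by apply: eq_bigr => j _; rewrite !mxE pb.
by rewrite -(slotP _ _ pb) /position; lia.
Qed.

Definition target (a : 'I_m) : 'I_k.+1 := inord (position a).

Lemma slot_target a : slot (target a) = Some a.
Proof. by rewrite inordK ?slot_position // ltnS ltnW ?position_lt. Qed.

Lemma hard_stream_decodes (eta : R) x a j (o : R) :
  0 < eta < 1 -> (m <= 1)%N \/ (m < W)%N ->
  (forall b, b != a ->
    expR ((keys b *m (queries a)^T) 0 0) * (k.+1%:R * (1 + eta)) <=
    (1 - eta) * expR ((keys a *m (queries a)^T) 0 0)) ->
  `|o - stream_attn W (hard_stream x a) 0 j| <=
    eta * stream_attn W (hard_stream x a) 0 j ->
  ((1 - eta) * softmax (scores a) (target a) 0 <= o) = x (a, j).
Proof.
move=> eta01 mW gap; rewrite stream_attnE => close.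
rewrite (threshold_decodes _ _ (fun p => stream_bit x j p) _ _
           eta01 _ _ close).
- by rewrite /stream_bit slot_target.
- by move=> p; exact: softmax_gt0.
- move=> p; rewrite /stream_bit; case E: (slot p) => [b|//] pa _.
  have ba : b != a.
    apply: contraNneq pa => ba; apply/eqP/val_inj.
    by rewrite -ba /= inordK ?(slotP _ _ E) // ltnW ?ltnS.
  (* Two distinct rows exclude m <= 1. *)
  have {mW} mW : (m < W)%N.
    case: mW => // m1; move: ba; rewrite -val_eqE /=.
    by have := ltn_ord a; have := ltn_ord b; lia.
  rewrite !softmaxE (scoresE _ _ _ mW E) (scoresE _ _ _ mW (slot_target a)).
  by rewrite mulrAC [leRHS]mulrA ler_pM2r ?gap // invr_gt0 sum_expR_gt0.
Qed.

End HardStream.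

(** * From an algorithm to an encoding of bit strings *)

Lemma measurable_approximation {R : realType} {disp : measure_display}
    {Om : measurableType disp} {d : nat} (eta : R) (o : Om -> 'rV[R]_d)
    (a : 'rV[R]_d) :
  (forall j, measurable_fun setT (fun w => o w 0 j)) ->
  measurable [set w | forall j, `|o w 0 j - a 0 j| <= eta * a 0 j].
Proof.
move=> mo; rewrite (_ : mkset _ = \bigcap_(j in setT)
  ((fun w => o w 0 j) @^-1`
     `[a 0 j - eta * a 0 j, a 0 j + eta * a 0 j]%classic)).
  apply: fin_bigcap_measurable => // j _.
  by rewrite -[X in measurable X]setTI; apply: mo => //; exact: measurable_itv.
apply/seteqP; split => [w close j _|w close j] /=.
  by rewrite in_itv /= -ler_distl.
by have := close j I; rewrite /= in_itv /= -ler_distl.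
Qed.

Lemma separated_keys_bound (R : realType) (eta : R) (X : set R) (k m d W : nat)
    (keys queries : 'I_m -> 'rV[R]_d) (disp : measure_display)
    (Om : measurableType disp) (P : probability Om R) (s : nat)
    (A : streaming_alg R Om s d) :
  0 < eta < 1 -> (0 < m <= k)%N -> (m <= 1)%N \/ (m < W)%N -> X 0 -> X 1 ->
  (forall a j, X (keys a 0 j)) -> (forall a j, X (queries a 0 j)) ->
  (forall a b, b != a ->
    expR ((keys b *m (queries a)^T) 0 0) * (k.+1%:R * (1 + eta)) <=
    (1 - eta) * expR ((keys a *m (queries a)^T) 0 0)) ->
  approximates_attn A P eta X k.+1 W ->
  (d * m <= 4 * s)%N.
Proof.
move=> eta01 /andP[m_gt0 m_le_k] mW X0 X1 Xk Xq gap approx.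
pose bits := {ffun 'I_m * 'I_d -> bool}.
pose xs (i : bits * 'I_m) := hard_stream k keys queries i.1 i.2.
have Xxs i : entries_in X (xs i).
  move=> p j; rewrite tnth_stream; case: ifP => _;
    last by split; rewrite /= ?mxE.
  case: slot => [a|]; split; rewrite /= ?mxE //.
  by case: (i.1 _).
have xs_ge0 i j : 0 <= stream_attn W (xs i) 0 j.
  rewrite stream_attnE //; apply: sumr_ge0 => p _.
  by rewrite mulr_ge0 // ltW // softmax_gt0.
pose E i := [set w | forall j : 'I_d,
  `|final_output A w (xs i) 0 j - stream_attn W (xs i) 0 j|
    <= eta * stream_attn W (xs i) 0 j].
have mE i : measurable (E i).
  by apply: measurable_approximation => j; exact: measurable_final_output.
have PE i : ((9 / 10 : R)%:E <= P (E i))%E by exact: approx.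
have [w many] :=
  exists_average_outcome P ([ffun=> false], Ordinal m_gt0) E mE PE.
(* For the fixed [w], [f] encodes by the memory before the query, and [g] decodes by feeding that
   memory each possible query. *)
pose f (x : bits) := memory A w 0 (init A) (hard_prefix k keys x).
pose g (mu : s.-tuple bool) : bits := [ffun aj =>
  (1 - eta) * softmax (scores k keys queries W aj.1) (target k aj.1) 0 <=
  out A w k mu (query_token queries aj.1) 0 aj.2].
have good x a j : w \in E (x, a) -> g (f x) (a, j) = x (a, j).
  rewrite inE => /(_ j) close; rewrite ffunE.
  apply: (hard_stream_decodes _ keys queries m_le_k W eta) => //.
    exact: gap.
  move: close; rewrite /final_output.
  rewrite [run _ _ _ _ _ _](run_rcons A w 0 _ _ (hard_prefix k keys x)).
  by rewrite size_tuple.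
(* A failed pair spoils at most the [d] bits of one row. *)
have bad x : (hamming (g (f x)) x <= d * \sum_a (w \notin E (x, a)))%N.
  rewrite big_distrr /= (eq_bigr (fun a => \sum_(j < d) (w \notin E (x, a)))%N).
    rewrite pair_bigA; apply: leq_sum => -[a j] _ /=.
    by have [/good ->|] := boolP (w \in E (x, a)); rewrite ?eqxx ?leq_b1.
  by move=> a _; rewrite sum_nat_const card_ord.
have total : (\sum_x \sum_a (w \notin E (x, a)) + \sum_i (w \in E i) =
    #|{: bits * 'I_m}|)%N.
  rewrite pair_bigA -big_split /= -sum1_card; apply: eq_bigr => -[x a] _ /=.
  by case: (w \in _).
have cardI : #|{: bits * 'I_m}| = (2 ^ (m * d) * m)%N.
  by rewrite card_prod card_ord card_ffun card_bool card_prod !card_ord.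
rewrite mulnC -[(m * d)%N](_ : #|{: 'I_m * 'I_d}| = _); last first.
  by rewrite card_prod !card_ord.
apply: (average_hamming_bound R _ _ f g).
  by rewrite card_tuple card_bool.
rewrite card_prod !card_ord.
have : (\sum_x hamming (g (f x)) x <= d * \sum_x \sum_a (w \notin E (x, a)))%N.
  by rewrite big_distrr /=; apply: leq_sum => x _; exact: bad.
(* At most a tenth of the [2 ^ (m * d) * m] pairs fail, each costing at most [d] bits. *)
move: many total; rewrite cardI; nia.
Qed.

(** * Keys on a parabola *)

(** Entries are integer casts, to match [has_small_ints]; the default of [nth] makes all coordinates
    after the second 0. *)
Definition parabola_key {R : realType} {d m : nat} (a : 'I_m) : 'rV[R]_d :=
  \row_j (nth 0 [:: a%:Z; (a ^ 2)%N%:Z] j)%:~R.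

Definition tangent_query {R : realType} {d m : nat} (L : nat) (a : 'I_m) :
    'rV[R]_d :=
  \row_j (nth 0 [:: (2 * a * L)%N%:Z; - L%:Z] j)%:~R.

Lemma parabola_score {R : realType} {d m : nat} (L : nat) (a b : 'I_m) :
  (1 < d)%N ->
  ((parabola_key b : 'rV[R]_d) *m (tangent_query L a)^T) 0 0 =
    L%:R * a%:R ^+ 2 - L%:R * (a%:R - b%:R) ^+ 2.
Proof.
case: d => [|[|d]] // _; rewrite !mxE !big_ord_recl !mxE /= big1 => [|j _].
  rewrite mulrNz -!pmulrn !natrM; ring.
by rewrite !mxE /= nth_nil mul0r.
Qed.

(** Distinct integers have squared distance at least 1, so the scores differ by some v >= L, and exp
    v >= 1 + v > L covers the required factor. *)
Lemma parabola_separated {R : realType} {d m : nat} (eta : R) (n L : nat)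
    (a b : 'I_m) :
  (1 < d)%N -> eta < 1 -> n%:R * (1 + eta) <= (1 - eta) * L%:R -> b != a ->
  expR (((parabola_key b : 'rV[R]_d) *m (tangent_query L a)^T) 0 0) *
    (n%:R * (1 + eta)) <=
  (1 - eta) *
    expR (((parabola_key a : 'rV[R]_d) *m (tangent_query L a)^T) 0 0).
Proof.
move=> d_gt1 eta_lt1 L_large ba; rewrite !parabola_score //.
rewrite subrr expr0n mulr0 subr0.
set t := L%:R * a%:R ^+ 2; set v := L%:R * _ ^+ 2.
have ->: expR t = expR (t - v) * expR v by rewrite -expRD subrK.
rewrite [leRHS]mulrCA ler_pM2l ?expR_gt0 //; apply: (le_trans L_large).
rewrite ler_pM2l ?subr_gt0 //.
have sq_ge1 : 1 <= (a%:R - b%:R : R) ^+ 2.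
  move: ba; rewrite -val_eqE neq_ltn /= => /orP[] lt_ab;
    move: lt_ab; rewrite -(ler_nat R) -natr1; nra.
have Lv : L%:R <= v by rewrite /v ler_peMr.
by apply: (le_trans Lv); have := expR_ge1Dx v; lra.
Qed.

(** * Choice of constants and cases on [d] and [W] *)

Theorem theorem17 (R : realType) (eta C : R) :
  0 < eta < 1 -> 0 < C ->
  exists (c : R) (b : nat), 0 < c /\
    forall n W d : nat,
      (1 < n)%N -> (0 < W <= n)%N -> C * ln (n%:R : R) <= d%:R ->
    forall X : set R, has_small_ints n b X ->
    forall (disp : measure_display) (Om : measurableType disp)
           (P : probability Om R) (s : nat) (A : streaming_alg R Om s d),
      approximates_attn A P eta X n W ->
      c * (d * W)%:R <= s%:R.
Proof.
move=> eta01 C_gt0; have /andP[eta_gt0 eta_lt1] := eta01.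
(* Since n >= 2, n^e >= 2^e >= 2 / (1 - eta), so L = n^(e + 1) meets the gap condition. *)
pose e := Num.bound (2 / (1 - eta)).
have e_large : 2 <= (1 - eta) * (2 ^ e)%:R :> R.
  rewrite mulrC -ler_pdivrMr ?subr_gt0 //; apply: ltW.
  have := archi_boundP (_ : 0 <= 2 / (1 - eta)).
  rewrite divr_ge0 ?subr_ge0 ?ltW // => /(_ isT).
  by move/lt_le_trans; apply; rewrite ler_nat ltnW // ltn_expl.
(* The exponential pays for d = 1; 8 is 4 times the loss in W <= 2 (W - 1). Query entries are at
   most 2 n L <= n^(e + 3). *)
exists (expR (- C^-1) / 8), (e + 3)%N.
split; first by rewrite divr_gt0 ?expR_gt0.
move=> [//|k] W d n_gt1 /andP[W_gt0 W_le] d_large X Xint disp Om P s A approx.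
have X0 : X 0 by apply: (Xint 0).
have X1 : X 1 by apply: (Xint 1); rewrite expn_gt0.
have c_le1 : expR (- C^-1) <= 1.
  by rewrite -expR0 ler_expR oppr_le0 invr_ge0 ltW.
have ln_gt0 : 0 < ln (k.+1%:R : R) by rewrite ln_gt0 // ltr1n.
have d_gt0 : (0 < d)%N.
  by rewrite -(ltr_nat R); apply: lt_le_trans d_large; rewrite mulr_gt0.
have crude : (d * W <= 8 * s)%N -> expR (- C^-1) / 8 * (d * W)%:R <= s%:R.
  rewrite -(ler_nat R) !natrM => dW.
  have : expR (- C^-1) * (d%:R * W%:R) <= 1 * (d%:R * W%:R).
    by rewrite ler_wpM2r // mulr_ge0.
  lra.
have [/andP[d_gt1 W_gt1]|small] := boolP ((1 < d) && (1 < W))%N.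
  apply: crude; pose L := (k.+1 ^ e.+1)%N.
  have L_large : k.+1%:R * (1 + eta) <= (1 - eta) * L%:R.
    rewrite /L expnS natrM mulrCA ler_pM2l ?ltr0n //.
    apply: (@le_trans _ _ 2); first by lra.
    apply: (le_trans e_large); rewrite ler_pM2l ?subr_gt0 // ler_nat.
    by rewrite leq_exp2r //.
  have bE : (k.+1 ^ (e + 3) = k.+1 ^ 2 * L)%N.
    by rewrite -expnD; congr (_ ^ _)%N; lia.
  have L_gt0 : (0 < L)%N by rewrite expn_gt0.
  have n2_le : (k.+1 ^ 2 <= k.+1 ^ (e + 3))%N by rewrite bE leq_pmulr.
  have a_le (a : 'I_W.-1) : (a <= k.+1)%N by have := ltn_ord a; lia.
  have bound : (d * W.-1 <= 4 * s)%N.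
    apply: (separated_keys_bound R eta X k W.-1 d W parabola_key
              (tangent_query L) _ _ P s A eta01 _ _ X0 X1 _ _ _ approx).
    - by lia.
    - by right; lia.
    - move=> a j; rewrite mxE; apply: Xint; move: a_le => /(_ a) a_le.
      case: (nat_of_ord j) => [|[|i]] /=; rewrite ?nth_nil //; first by nia.
      by apply: leq_trans n2_le; rewrite leq_exp2r.
    - move=> a j; rewrite mxE; apply: Xint; move: a_le => /(_ a) a_le.
      case: (nat_of_ord j) => [|[|i]] /=; rewrite ?nth_nil // ?abszN /=; nia.
    - by move=> a b; apply: parabola_separated.
  nia.
(* With a single row the gap condition is vacuous, so zero keys and queries do. *)
have bound : (d * 1 <= 4 * s)%N.
  apply: (separated_keys_bound R eta X k 1 d W (fun=> 0) (fun=> 0)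
            _ _ P s A eta01 _ _ X0 X1 _ _ _ approx).
  - by lia.
  - by left.
  - by move=> a j; rewrite mxE.
  - by move=> a j; rewrite mxE.
  - by move=> a b; rewrite !ord1 eqxx.
have [W1|W_gt1] := leqP W 1; first by apply: crude; nia.
have d1 : d = 1%N by lia.
rewrite d1 in d_large bound *; rewrite mul1n.
(* Now C ln n <= 1 bounds n, hence W, by exp (1 / C), and s >= 1 is enough. *)
have n_le : k.+1%:R <= expR C^-1.
  by rewrite -ler_ln ?posrE ?ltr0n ?expR_gt0 // expRK -[leRHS]mulr1 ler_pdivlMl.
have : expR (- C^-1) * W%:R <= 1.
  rewrite expRN mulrC ler_pdivrMr ?expR_gt0 // mul1r.
  by apply: (le_trans _ n_le); rewrite ler_nat.
have : 1 <= s%:R :> R by rewrite ler1n; lia.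
lra.
Qed.
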